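(* Let $\mathfrak{a}$ be a 2-absorbing ideal of a subtractive semiring $S$. Then one of the following statements must hold: (1) $\sqrt{\mathfrak{a}}=\mathfrak{p}$ is a prime ideal of $S$ such that $\mathfrak{p}^2\subseteq\mathfrak{a}$. (2) $\sqrt{\mathfrak{a}}=\mathfrak{p}_1\cap\mathfrak{p}_2$, $\mathfrak{p}_1\mathfrak{p}_2\subseteq\mathfrak{a}$ and $(\sqrt{\mathfrak{a}})^2\subseteq\mathfrak{a}$, where $\mathfrak{p}_1,\mathfrak{p}_2$ are the only distinct prime ideals of $S$ that are minimal over $\mathfrak{a}$.
   Context: A semiring is a set $S$ with operations $+,\cdot$ and elements $0\neq 1$ such that $(S,+,0)$ is a commutative monoid, $(S,\cdot,1)$ is a monoid, multiplication distributes over addition on both sides, and $a\cdot 0=0\cdot a=0$ for all $a\in S$. All semirings are assumed commutative (multiplication is commutative). An ideal of $S$ is a nonempty subset $\mathfrak{a}$ closed under addition with $sx\in\mathfrak{a}$ for all $s\in S$, $x\in\mathfrak{a}$; it is proper if $\mathfrak{a}\neq S$. The product of ideals is $IJ=\{\sum_{i=1}^n a_ib_i : a_i\in I,\ b_i\in J,\ n\in\mathbb{N}\}$, and $I^2=II$. The radical is $\sqrt{\mathfrak{a}}=\{s\in S: s^n\in\mathfrak{a}\text{ for some } n\in\mathbb{N}\}$. An ideal $\mathfrak{a}$ is subtractive if $x+y\in\mathfrak{a}$ and $x\in\mathfrak{a}$ imply $y\in\mathfrak{a}$ for all $x,y\in S$; $S$ is subtractive if every ideal of $S$ is subtractive.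 A proper ideal $\mathfrak{p}$ is prime if $ab\in\mathfrak{p}$ implies $a\in\mathfrak{p}$ or $b\in\mathfrak{p}$. A prime ideal is minimal over $\mathfrak{a}$ if it is minimal (under inclusion) among the prime ideals containing $\mathfrak{a}$. A proper ideal $\mathfrak{a}$ is 2-absorbing if, for $x,y,z\in S$, $xyz\in\mathfrak{a}$ implies $xy\in\mathfrak{a}$ or $yz\in\mathfrak{a}$ or $xz\in\mathfrak{a}$. *)

(* Defs.v *)
From mathcomp Require Import all_boot all_algebra.
From mathcomp Require Import classical_sets.

Set Implicit Arguments.
Unset Strict Implicit.
Unset Printing Implicit Defensive.

Import GRing.Theory.

Local Open Scope ring_scope.
Local Open Scope classical_set_scope.

(* Ideals are Prop-valued sets: the ideal predicates of ring_quotient are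
   boolean and require a ring with subtraction. *)
Section SemiringIdeals.
Variable S : comNzSemiRingType.
Implicit Types (a p q I J : set S).

Definition is_ideal a : Prop :=
  [/\ a !=set0,
      forall x y, a x -> a y -> a (x + y) &
      forall s x, a x -> a (s * x)].

Definition is_proper_ideal a : Prop := is_ideal a /\ a <> setT.

Definition ideal_prod I J : set S :=
  [set x | exists (n : nat) (u v : 'I_n -> S),
     [/\ forall i, I (u i), forall i, J (v i) & x = \sum_(i < n) u i * v i]].

(* Exponent 0 is harmless: if 1 lies in an ideal, so does every element. *)
Definition radical a : set S := [set s | exists n : nat, a (s ^+ n)].

Definition is_subtractive_ideal a : Prop :=
  is_ideal a /\ forall x y, a (x + y) -> a x -> a y.

Definition is_prime_ideal p : Prop :=
  is_proper_ideal p /\ forall x y, p (x * y) -> p x \/ p y.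

Definition is_minimal_prime_over a p : Prop :=
  [/\ is_prime_ideal p, a `<=` p &
      forall q, is_prime_ideal q -> a `<=` q -> q `<=` p -> q = p].

Definition is_two_absorbing a : Prop :=
  is_proper_ideal a /\
  forall x y z, a (x * y * z) -> [\/ a (x * y), a (y * z) | a (x * z)].

End SemiringIdeals.

Definition subtractive_semiring (S : comNzSemiRingType) : Prop :=
  forall a : set S, is_ideal a -> is_subtractive_ideal a.

(* Main.v *)
(** Write r for the radical of a.  The 2-absorbing property gives
    r = {s | s^2 in a}, and r is again 2-absorbing.  The key point is that three
    elements u, v, w with pairwise products in r cannot all lie outside r: apply
    the 2-absorbing property to (u + v)(v + w)(u + w) and cancel by
    subtractivity.  If r is not prime, choose x, y outside r with xy in r; the
    key point makes the colon ideals (r : x) and (r : y) prime with intersection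
    r, so the two minimal primes are found without Zorn's lemma. *)

Require Import Defs.
From mathcomp Require Import all_boot all_algebra.
From mathcomp Require Import classical_sets boolp.
From mathcomp Require Import ring.

Import GRing.Theory.

Local Open Scope ring_scope.
Local Open Scope classical_set_scope.

Section Ideals.
Variable S : comNzSemiRingType.
Implicit Types (a p I J : set S) (x y z : S).

Lemma ideal0 {a} : is_ideal a -> a 0.
Proof. by case=> [[x ax] _ aM]; rewrite -(mul0r x); exact: aM. Qed.

Lemma idealD {a x y} : is_ideal a -> a x -> a y -> a (x + y).
Proof. by case=> _ aD _; exact: aD. Qed.

Lemma idealMl {a} s {x} : is_ideal a -> a x -> a (s * x).
Proof. by case=> _ _; exact. Qed.

Lemma idealMr {a x} s : is_ideal a -> a x -> a (x * s).
Proof. by rewrite mulrC; exact: idealMl. Qed.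

Lemma ideal_prod_sub I J a : is_ideal a ->
  (forall x y, I x -> J y -> a (x * y)) -> ideal_prod I J `<=` a.
Proof.
move=> aI IJa _ [n [u [v [Iu Jv ->]]]].
apply: (big_ind a) => [|x y|i _]; first exact: ideal0.
- exact: idealD.
- exact: IJa.
Qed.

Lemma prime_exp p x n : is_prime_ideal p -> p (x ^+ n) -> p x.
Proof.
move=> [[pI _] pM]; elim: n => [|n IHn].
  by rewrite expr0 => p1; rewrite -(mulr1 x); exact: idealMl.
by rewrite exprS => /pM[].
Qed.

Definition ideal_colon a x : set S := [set s | a (s * x)].

Lemma ideal_colon_ideal a x : is_ideal a -> is_ideal (ideal_colon a x).
Proof.
move=> aI; split=> [|u v au av|s u au]; rewrite /ideal_colon /=.
- by exists 0; rewrite /= mul0r; exact: ideal0.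
- by rewrite mulrDl; exact: idealD.
- by rewrite -mulrA; exact: idealMl.
Qed.

End Ideals.

Arguments ideal_colon {S} a x.

Section TwoAbsorbing.
Variables (S : comNzSemiRingType) (hS : subtractive_semiring S).
Variables (a : set S) (ha : is_two_absorbing a).
Implicit Types (u v w x y z : S).

Let r := radical a.

Let aI : is_ideal a. Proof. by case: ha => -[]. Qed.

Lemma idealDK {I : set S} {x y} : is_ideal I -> I x -> I (x + y) -> I y.
Proof. by move=> /hS[_ IDK] Ix Ixy; exact: IDK Ix. Qed.

(** Split [x ^+ n.+2] as x * x * x^n: the 2-absorbing property yields either the square in [a] or a
    power with exponent one lower. *)
Lemma radicalP x : r x <-> a (x * x).
Proof.
split=> [[n]|axx]; last by exists 2%N; rewrite expr2.
elim: n => [|[_|n IHn]].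
- by rewrite expr0 => a1; rewrite -(mulr1 (x * x)); exact: idealMl.
- by rewrite expr1 => ax; exact: idealMl.
- rewrite 2!exprS mulrA => axxx.
  by case: ha => _ /(_ _ _ _ axxx)[//||] ax; apply: IHn; rewrite exprS.
Qed.

Lemma sub_radical : a `<=` r.
Proof. by move=> x ax; exists 1%N; rewrite expr1. Qed.

(** The product xy(x + y) lies in [a]. Absorption gives xy at once, or y(x + y) or x(x + y), from
    which subtractivity removes the square. *)
Lemma radical_mul x y : r x -> r y -> a (x * y).
Proof.
move=> /radicalP axx /radicalP ayy.
have : a (x * y * (x + y)).
  have -> : x * y * (x + y) = y * (x * x) + x * (y * y) by ring.
  by apply: idealD => //; exact: idealMl.
case: ha => _ abs /abs[//||] axy.
- by move: axy; rewrite mulrDr addrC (mulrC y x); exact: idealDK.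
- by move: axy; rewrite mulrDr; exact: idealDK.
Qed.

Lemma radical_ideal : is_ideal r.
Proof.
split=> [|x y rx ry|s x /radicalP axx].
- by exists 0; apply: sub_radical; exact: ideal0.
- apply/radicalP; rewrite mulrDl !mulrDr.
  by do ![apply: idealD => //]; exact: radical_mul.
- by apply/radicalP; rewrite mulrACA; exact: idealMl.
Qed.

Let rI := radical_ideal.

Lemma radical_sq x : r (x * x) -> r x.
Proof. by case=> n; rewrite -expr2 -exprM => axn; exists (2 * n)%N. Qed.

(** Squaring turns this into the 2-absorbing property of [a] at x^2, y^2, z^2. *)
Lemma radical_abs x y z : r (x * y * z) -> [\/ r (x * y), r (y * z) | r (x * z)].
Proof.
move=> /radicalP; rewrite mulrACA (mulrACA x y).
case: ha => _ abs /abs[]; rewrite mulrACA => ?.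
- by apply: Or31; apply/radicalP.
- by apply: Or32; apply/radicalP.
- by apply: Or33; apply/radicalP.
Qed.

Lemma radical_pairwise u v w :
  r (u * v) -> r (v * w) -> r (u * w) -> [\/ r u, r v | r w].
Proof.
(* (x + y)(y + z) is y^2 plus three products already in [r], so subtractivity leaves y^2 in [r]. *)
have sqP x y z : r (x * y) -> r (y * z) -> r (x * z) ->
    r ((x + y) * (y + z)) -> r y.
  move=> rxy ryz rxz rD; apply: radical_sq.
  apply: (@idealDK _ (x * y + x * z + y * z)) => //.
    by do ![apply: idealD => //].
  by congr r: rD; ring.
move=> ruv rvw ruw.
have : r ((u + v) * (v + w) * (w + u)).
  have -> : (u + v) * (v + w) * (w + u) =
    (u + v + w + w) * (u * v) + (v + w) * (v * w) + (u + w) * (u * w) by ring.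
  by do ![apply: idealD => //]; exact: idealMl.
case/radical_abs => rD.
- by apply: Or32; apply: (@sqP u v w).
- by apply: Or33; apply: (@sqP v w u); rewrite // mulrC.
- apply: Or31; apply: (@sqP v u w); rewrite // 1?mulrC //.
  by rewrite [X in X * _]addrC mulrC (addrC v).
Qed.

Lemma radical_proper : r <> setT.
Proof.
move=> rT; case: ha => -[_ aT] _; apply: aT; apply/seteqP; split=> // x _.
have /radicalP a1 : r 1 by rewrite rT.
by rewrite -(mulr1 x) -(mulr1 1); exact: idealMl.
Qed.

Section ZeroDivisors.
Variables (x y : S).
Hypotheses (rx : ~ r x) (ry : ~ r y) (rxy : r (x * y)).

Lemma colon_prime : is_prime_ideal (ideal_colon r x).
Proof.
split; first split; first exact: ideal_colon_ideal.
  move=> cT; apply: rx; rewrite -(mul1r x).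
  by have : ideal_colon r x 1 by rewrite cT.
rewrite /ideal_colon /= => u v ruvx.
apply: contrapT => /not_orP[rux rvx].
have ruv : r (u * v) by case/radical_abs: ruvx.
(* Absorb (y + s)xt, which lies in [r] because xy and st do. Cancelling xy or st from the resulting
   pairs gives sx, xt or yt, and the first two are excluded. *)
have killy s t : r (s * t) -> ~ r (s * x) -> ~ r (t * x) -> r (t * y).
  move=> rst rsx rtx.
  have : r ((y + s) * x * t).
    have -> : (y + s) * x * t = t * (x * y) + x * (s * t) by ring.
    by apply: idealD => //; exact: idealMl.
  case/radical_abs.
  - rewrite mulrDl (mulrC y x) => rD; case: rsx; exact: idealDK rD.
  - by rewrite mulrC => /rtx.
  - rewrite mulrDl addrC => rD.
    by rewrite mulrC; exact: idealDK rD.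
have rvy : r (v * y) by exact: (killy u).
have ruy : r (u * y) by apply: (killy v) => //; rewrite mulrC.
(* Now u, v, y have pairwise products in [r], while y is outside [r]. *)
case: (radical_pairwise _ _ _ ruv rvy ruy) => // ?; [apply: rux|apply: rvx];
  exact: idealMr.
Qed.

Lemma radical_colonI : r = ideal_colon r x `&` ideal_colon r y.
Proof.
apply/seteqP; split=> [z rz|z [rzx rzy]].
  by split; exact: idealMr.
by case: (radical_pairwise _ _ _ rzx rxy rzy).
Qed.

Lemma prime_colon_sub q : is_prime_ideal q -> a `<=` q ->
  ~ q x -> ideal_colon r x `<=` q.
Proof.
move=> qP aq qx u [n /aq /(prime_exp _ _ _ _ qP)].
by case: qP => _ /[apply] -[].
Qed.

End ZeroDivisors.

(** Read (uv)^2 as u * u * v^2, then u * v^2 as u * v * v; the squares of u and v are barred from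
    [a], so each absorption leaves only the wanted alternative. *)
Lemma radical_mul_notin u v : ~ r u -> ~ r v -> r (u * v) -> a (u * v).
Proof.
move=> ru rv /radicalP; rewrite mulrACA.
case: ha => _ abs /abs[/radicalP //||]; rewrite mulrA => /abs[] //;
  by move/radicalP.
Qed.

Lemma radical_colon_mul u v y : ~ r y -> r u -> r (v * y) -> a (u * v).
Proof.
move=> ry ru rvy; have [rv|rv] := pselect (r v); first exact: radical_mul.
have ryv : r (y * v) by rewrite mulrC.
(* Since u lies in [r], uv is obtained as the difference of (y + u)v and yv, whose factors all lie
   outside [r]. *)
apply: (@idealDK _ (y * v)) => //; first exact: radical_mul_notin.
rewrite -mulrDl; apply: radical_mul_notin => //.
  by rewrite addrC => ruy; apply: ry; exact: idealDK ruy.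
by rewrite mulrDl; apply: idealD => //; exact: idealMr.
Qed.

Lemma colon_mul x y u v : ~ r x -> ~ r y -> r (x * y) ->
  ideal_colon r x u -> ideal_colon r y v -> a (u * v).
Proof.
move=> rx ry rxy rux rvy.
have [ru|ru] := pselect (r u); first exact: (@radical_colon_mul _ _ y).
have [rv|rv] := pselect (r v).
  by rewrite mulrC; exact: (@radical_colon_mul _ _ x).
(* With both factors outside [r], it suffices that uv lies in both colon ideals, whose intersection
   is [r]. *)
apply: radical_mul_notin => //; rewrite (radical_colonI x y) //; split.
  by rewrite /ideal_colon /= mulrAC; exact: idealMr.
by rewrite /ideal_colon /= -mulrA; exact: idealMl.
Qed.

Lemma colon_minimal x y : ~ r x -> ~ r y -> r (x * y) ->
  is_minimal_prime_over a (ideal_colon r x).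
Proof.
move=> rx ry rxy; split=> [||q qP aq qc].
- exact: (@colon_prime x y).
- by move=> u /sub_radical ru; exact: idealMr.
apply/seteqP; split=> //; apply: prime_colon_sub => //.
(* If x were in [q], it would lie in its own colon ideal, so x^2 and hence x would be in [r]. *)
by move=> /qc /radical_sq.
Qed.

Lemma minimal_primeE x y q : ~ r x -> ~ r y -> r (x * y) ->
  is_minimal_prime_over a q <-> q = ideal_colon r x \/ q = ideal_colon r y.
Proof.
move=> rx ry rxy; have ryx : r (y * x) by rewrite mulrC.
have xmin := colon_minimal _ _ rx ry rxy.
have ymin := colon_minimal _ _ ry rx ryx.
split=> [[qP aq qmin]|[]-> //].
have [xP ax _] := xmin; have [yP ay _] := ymin.
have [xq|] := pselect (ideal_colon r x `<=` q); first by left; rewrite (qmin _ xP ax).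
(* A single u in (r : x) outside [q] suffices: uv lies in [a], hence in [q], for every v in (r : y),
   so primality puts (r : y) inside [q]. *)
move=> /existsNP[u /not_implyP[rux qu]]; right; rewrite (qmin _ yP ay) // => v rvy.
case: qP => _ /(_ u v)[|/qu|] //; apply: aq; exact: (colon_mul x y).
Qed.

End TwoAbsorbing.

Theorem theorem3p8 (S : comNzSemiRingType) (hS : subtractive_semiring S)
    (a : set S) (ha : is_two_absorbing a) :
  (exists p : set S,
     [/\ radical a = p, is_prime_ideal p & ideal_prod p p `<=` a])
  \/
  (exists p1 p2 : set S,
     [/\ p1 <> p2,
         (forall q : set S, is_minimal_prime_over a q <-> q = p1 \/ q = p2),
         radical a = p1 `&` p2,
         ideal_prod p1 p2 `<=` a &
         ideal_prod (radical a) (radical a) `<=` a]).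
Proof.
have aI : is_ideal a by case: ha => -[].
have rr : ideal_prod (radical a) (radical a) `<=` a.
  by apply: ideal_prod_sub => // x y; exact: radical_mul.
have [rP|rnP] := pselect (is_prime_ideal (radical a)).
  by left; exists (radical a).
have [x [y [rx [ry rxy]]]] :
    exists x y, ~ radical a x /\ ~ radical a y /\ radical a (x * y).
  apply: contrapT => nxy; apply: rnP; split.
    by split; [exact: radical_ideal | exact: radical_proper].
  move=> x y rxy; apply: contrapT => /not_orP[rx ry].
  by apply: nxy; exists x, y.
right; exists (ideal_colon (radical a) x), (ideal_colon (radical a) y); split=> //.
(* The element y separates the two primes: it lies in (r : x), but in (r : y) only if y^2 is in the
   radical. *)
- move=> cxy; have : ideal_colon (radical a) y y by rewrite -cxy /= /ideal_colon /= mulrC.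
  by move/radical_sq.
- by move=> q; exact: minimal_primeE.
- exact: radical_colonI.
- by apply: ideal_prod_sub => // u v; exact: colon_mul.
Qed.
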